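(* Let $q\ge 2$ be a real number and let $n\in\mathbb{N}_0$ be even. Let $\mathcal{Q}_q$ be the distribution on $\mathbb{N}_0$ with mass function $$p_k=\frac{1}{q^{k^2}}\,\frac{\prod_{i=k+1}^\infty(1-1/q^i)}{\prod_{i=1}^k(1-1/q^i)},\qquad k\in\mathbb{N}_0,$$ and let $\mathcal{Q}_{q,n}$ be the distribution on $\{0,\dots,n/2\}$ with mass function $$p_{k,n}=\frac{N(n,n-2k)}{q^{(n/2)^2}},\qquad N(n,2h)=\prod_{j=0}^{n/2-h-1}\frac{q^{n/2}-q^j}{q^{n/2-h}-q^j}\ \prod_{i=0}^{h-1}(q^{n/2}-q^i).$$ Then $$\frac{1}{8\,q^{n/2+1}}\le\|\mathcal{Q}_{q,n}-\mathcal{Q}_q\|_{\mathrm{TV}}\le\frac{3}{q^{n/2+1}} .$$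
   Context: $\mathbb{N}_0=\{0,1,2,\dots\}$. Empty products equal $1$. For probability distributions $P_1,P_2$ on a countable set $S$, $\|P_1-P_2\|_{\mathrm{TV}}=\frac12\sum_{s\in S}|P_1(s)-P_2(s)|$; a distribution on $\{0,\dots,n/2\}$ is regarded as a distribution on $\mathbb{N}_0$. An $n\times n$ matrix $A$ is skew centrosymmetric if $A_{ij}=-A_{ji}$ and $A_{ij}=A_{n+1-j,n+1-i}$; for $q$ an odd prime power and $n$ even, $p_{k,n}$ is the proportion of $n\times n$ skew centrosymmetric matrices over $\mathbb{F}_q$ having rank $n-2k$. *)

(* Defs.v *)
(* Built on Mathematical Components and MathComp-Analysis. *)
From mathcomp Require Import all_boot all_order all_algebra.
From mathcomp Require Import all_classical all_reals all_analysis.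

Set Implicit Arguments.
Unset Strict Implicit.
Unset Printing Implicit Defensive.

Import Order.TTheory GRing.Theory Num.Theory.
Import numFieldNormedType.Exports.

Local Open Scope ring_scope.

(* Distributions on a countable set are represented by their mass functions.
   The unordered sum of nonnegative terms is taken in the extended reals, so
   the distance is meaningful without any summability side condition. *)
Definition tv_dist (R : realType) (S : countType) (P1 P2 : S -> R) : \bar R :=
  ((2^-1)%:E * \esum_(s in [set: S]) `|P1 s - P2 s|%:E)%E.

Definition infinite_prod (R : realType) (m : nat) (u : nat -> R) : R :=
  limn (fun M : nat => \prod_(m <= i < M) u i).

Definition Qq_mass (R : realType) (q : R) (k : nat) : R :=
  1 / q ^+ (k ^ 2) *
  (infinite_prod k.+1 (fun i => 1 - 1 / q ^+ i) /
   \prod_(1 <= i < k.+1) (1 - 1 / q ^+ i)).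

(* [rank_count q n r] is N(n, r); only even [n] and even [r <= n], written
   [r = 2 h], are meaningful. *)
Definition rank_count (R : realType) (q : R) (n r : nat) : R :=
  let h := r./2 in
  \prod_(0 <= j < n./2 - h)
     ((q ^+ n./2 - q ^+ j) / (q ^+ (n./2 - h) - q ^+ j)) *
  \prod_(0 <= i < h) (q ^+ n./2 - q ^+ i).

(* A distribution on {0, ..., n/2}, extended by zero to all of nat. *)
Definition Qqn_mass (R : realType) (q : R) (n k : nat) : R :=
  if (k <= n./2)%N then rank_count q n (n - 2 * k) / q ^+ (n./2 ^ 2) else 0.

(* Main.v *)
Require Import Defs.
From mathcomp Require Import all_boot all_order all_algebra.
From mathcomp Require Import all_classical all_reals all_analysis.
From mathcomp Require Import zify ring lra.

Set Implicit Arguments.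
Unset Strict Implicit.
Unset Printing Implicit Defensive.

Import Order.TTheory GRing.Theory Num.Theory.
Import numFieldNormedType.Exports.

Local Open Scope ring_scope.

(** Put [x = 1/q], so [0 < x <= 1/2], and [m = n/2]; write [E a b] for the
    product of the [1 - x^i] over [a <= i < b] and [T a] for the infinite
    product over [i >= a].  Pulling the powers of [q] out of [N(n, n - 2k)]
    puts both mass functions over the same prefactor [x^(k^2) / E 1 (k+1)]:
    for [k <= m] the finite one is this prefactor times
    [E (k+1) (m+1) * E (m-k+1) (m+1)], the limiting one is the prefactor times
    [E (k+1) (m+1) * T (m+1)].  Hence the difference at [k] is governed by
    [E (m-k+1) (m+1) - T (m+1)] ([mass_diffE]), a difference of two products
    that are both close to [1].

    Upper bound.  A product of factors [1 - x^i] falls short of [1] by at most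
    the sum of the [x^i] ([qprod_deficit], [qprod_inf_deficit]).  The deficit
    of [E (m-k+1) (m+1)] is of order [x^(m-k+1)], a factor [x^(-k)] larger than
    the target [x^(m+1)], but the prefactor [x^(k^2)] absorbs the loss and
    still leaves [x^(k(k-1))], which beats [1 / E 1 k] geometrically
    ([pronic_pow_le]).  The masses at [k > m] carry the same [x^(k(k-1))].
    So the difference is at most [2 x^(m+1)] at [k = 0] and at most
    [2 * 2^(-j) x^(m+1)] at [k = j+1]; these add up to [6 x^(m+1)], and half
    of that is the bound.

    Lower bound.  The point [k = 0] alone suffices: there the difference is
    [E 1 (m+1) * (1 - T (m+1))].  Its second factor is at least [x^(m+1)], and
    its first is at least [1 - x - x^2 >= 1/4], the start of Euler's
    pentagonal number series ([qprod_ge_pentagonal]).  Halving gives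
    [x^(m+1) / 8]. *)

(** * Finite and infinite products of [1 - x^i] *)

Definition qprod (R : realType) (x : R) (a b : nat) : R :=
  \prod_(a <= i < b) (1 - x ^+ i).

Definition qprod_inf (R : realType) (x : R) (a : nat) : R :=
  infinite_prod a (fun i => 1 - x ^+ i).

Section QProducts.
Variables (R : realType) (x : R).
Hypotheses (x_gt0 : 0 < x) (x_le_half : x <= 2^-1).

Let x_ge0 : 0 <= x. Proof. exact: ltW. Qed.
Let x_le1 : x <= 1. Proof. by move: x_le_half; lra. Qed.

Let pow_ge0 i : 0 <= x ^+ i. Proof. exact: exprn_ge0. Qed.
Let pow_le1 i : x ^+ i <= 1. Proof. exact: exprn_ile1. Qed.

Lemma pow_le_half i : (0 < i)%N -> x ^+ i <= 2^-1.
Proof.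
case: i => // i _; rewrite exprS.
have := pow_ge0 i; have := pow_le1 i; move: x_ge0 x_le_half; nra.
Qed.

(** Since [1/2 <= 1 - x], this clears the denominator [1 - x] of the
    geometric series that bounds a deficit [d]. *)
Lemma le_double_of_deficit d y : 0 <= d -> (1 - x) * d <= y -> d <= 2 * y.
Proof. by move=> d0 dy; have := ler_wpM2r d0 x_le_half; lra. Qed.

Lemma qprod_id a : qprod x a a = 1.
Proof. by rewrite /qprod big_geq. Qed.

Lemma qprod_recr a b : (a <= b)%N ->
  qprod x a b.+1 = qprod x a b * (1 - x ^+ b).
Proof. by move=> ab; rewrite /qprod big_nat_recr. Qed.

Lemma qprod_recl a b : (a < b)%N ->
  qprod x a b = (1 - x ^+ a) * qprod x a.+1 b.
Proof. by move=> ab; rewrite /qprod big_ltn. Qed.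

Lemma qprod_cat a b c : (a <= b)%N -> (b <= c)%N ->
  qprod x a c = qprod x a b * qprod x b c.
Proof. by move=> ab bc; rewrite /qprod (big_cat_nat ab bc). Qed.

Lemma qprod_ge0 a b : 0 <= qprod x a b.
Proof. by rewrite /qprod; apply: prodr_ge0 => i _; rewrite subr_ge0. Qed.

Lemma qprod_gt0 a b : (0 < a)%N -> 0 < qprod x a b.
Proof.
move=> a0; rewrite /qprod big_seq; apply: prodr_gt0 => i.
rewrite mem_index_iota => /andP[ai _].
have := pow_le_half (leq_trans a0 ai); lra.
Qed.

Lemma qprod_le1 a b : qprod x a b <= 1.
Proof.
rewrite /qprod; apply: prodr_ile1 => i _.
by rewrite subr_ge0 pow_le1 gerBl pow_ge0.
Qed.

(** The Weierstrass inequality [1 - \prod (1 - x^i) <= \sum x^i], with the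
    geometric sum evaluated and its denominator cleared. *)
Lemma qprod_deficit a b : (a <= b)%N ->
  (1 - x) * (1 - qprod x a b) <= x ^+ a - x ^+ b.
Proof.
move=> /subnKC <-; elim: (b - a)%N => [|d IH].
  by rewrite addn0 qprod_id !subrr mulr0.
rewrite addnS qprod_recr ?leq_addr// exprS.
have := qprod_le1 a (a + d); have := pow_ge0 (a + d).
move: x_le1 IH; set P := qprod x a (a + d); set y := x ^+ (a + d).
move=> ? ? ? ?.
have : (1 - x) * (y * P) <= (1 - x) * y.
  by apply: ler_wpM2l; [lra | nra].
lra.
Qed.

(** The truncation [1 - x - x^2] of the pentagonal number series bounds the
    partial products from below; the extra [x^(b+1)] is the slack that makes
    the induction go through. *)
Lemma qprod_ge_pentagonal b : 1 - x - x ^+ 2 + x ^+ b.+1 <= qprod x 1 b.+1.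
Proof.
case: b => [|b]; first by rewrite qprod_id expr1; have := pow_ge0 2; lra.
elim: b => [|b IH]; first by rewrite qprod_recr// qprod_id expr1; lra.
rewrite qprod_recr//; apply: le_trans (ler_wpM2r _ IH); last first.
  by rewrite subr_ge0.
have : x ^+ b.+2 <= x ^+ 2.
  have -> : x ^+ b.+2 = x ^+ 2 * x ^+ b by rewrite -exprD add2n.
  by have := pow_le1 b; have := pow_ge0 2; nra.
rewrite (exprS x b.+2); have := pow_ge0 b.+2.
set y := x ^+ b.+2; set z := x ^+ 2 => y0 yz.
(* Multiplying [1 - x - z + y] by [1 - y] gives [1 - x - z + y (x + z - y)];
   the induction only asks for [x y] of the last term. *)
by rewrite -subr_ge0 [leRHS](_ : _ = y * (z - y)); [nra | ring].
Qed.

(** From [j] to [j+1] the left side gains the factor [x^(2(j+1))] and the right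
    side the factor [(1 - x^(j+1)) / 2]; the former is the smaller because
    [x^(j+1) <= 1/2].  Divided by the product, this makes the tail of the
    total variation sum geometric. *)
Lemma pronic_pow_le j : x ^+ (j * j.+1) <= 2^-1 ^+ j * qprod x 1 j.+1.
Proof.
elim: j => [|j IH]; first by rewrite mul0n qprod_id !expr0 mulr1.
have -> : (j.+1 * j.+2 = j * j.+1 + j.+1 * 2)%N by lia.
rewrite qprod_recr// exprD (exprM x j.+1 2) (exprS 2^-1 j).
have y0 := pow_ge0 j.+1; have yh := pow_le_half (ltn0Sn j).
rewrite (_ : 2^-1 * _ * _ =
  2^-1 ^+ j * qprod x 1 j.+1 * (2^-1 * (1 - x ^+ j.+1))); last by ring.
apply: ler_pM => //; first by rewrite exprn_ge0.
by rewrite expr2; nra.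
Qed.

Local Open Scope classical_set_scope.

Lemma qprod_cvg a : cvgn (qprod x a).
Proof.
apply: nonincreasing_is_cvgn.
  move=> b c bc; case: (leqP a b) => ab; last first.
    by rewrite [leRHS]/qprod big_geq ?(ltnW ab)// qprod_le1.
  by rewrite (qprod_cat ab bc) ler_piMr ?qprod_le1 ?qprod_ge0.
by exists 0 => _ [b _ <-]; exact: qprod_ge0.
Qed.

Lemma qprod_inf_cat a b : (a <= b)%N ->
  qprod_inf x a = qprod x a b * qprod_inf x b.
Proof.
move=> ab; apply: cvg_lim => //.
have h : (fun M => qprod x a b * qprod x b M) @ \oo -->
    qprod x a b * qprod_inf x b by apply: cvgMl_tmp; exact: qprod_cvg.
apply: cvg_trans h; apply: near_eq_cvg; near=> M.
have bM : (b <= M)%N by near: M; exact: nbhs_infty_ge.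
by rewrite -/(qprod x a M) (qprod_cat ab bM).
Unshelve. all: by end_near. Qed.

Lemma qprod_inf_ge0 a : 0 <= qprod_inf x a.
Proof.
by apply: limr_ge; [exact: qprod_cvg | apply: nearW => b; exact: qprod_ge0].
Qed.

Lemma qprod_inf_le1 a : qprod_inf x a <= 1.
Proof.
by apply: limr_le; [exact: qprod_cvg | apply: nearW => b; exact: qprod_le1].
Qed.

Lemma qprod_inf_deficit a : (1 - x) * (1 - qprod_inf x a) <= x ^+ a.
Proof.
have x1 : 0 < 1 - x by move: x_le_half; lra.
rewrite -ler_pdivlMl// lerBlDr -lerBlDl.
apply: limr_ge; [exact: qprod_cvg | near=> b].
have ab : (a <= b)%N by near: b; exact: nbhs_infty_ge.
rewrite lerBlDl -lerBlDr ler_pdivlMl// (le_trans (qprod_deficit ab))//.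
by rewrite gerBl.
Unshelve. all: by end_near. Qed.

Lemma qprod_inf_le a : qprod_inf x a <= 1 - x ^+ a.
Proof.
rewrite (qprod_inf_cat (leqnSn a)) qprod_recl// qprod_id mulr1.
by rewrite ler_piMr ?qprod_inf_le1// subr_ge0.
Qed.

End QProducts.

(** * Bounding the total variation distance *)

Section TotalVariation.
Variable R : realType.

Lemma tv_dist_ge_point (S : countType) (P1 P2 : S -> R) (s : S) :
  ((2^-1 * `|P1 s - P2 s|)%:E <= tv_dist P1 P2)%E.
Proof.
rewrite /tv_dist EFinM; apply: lee_wpmul2l; first by rewrite lee_fin invr_ge0.
apply: esum_ge; exists [set s]%classic; first by split.
by rewrite fsbig_set1.
Qed.

Lemma tv_dist_le_partial_sums (P1 P2 : nat -> R) (c : R) :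
  (forall N, \sum_(0 <= k < N) `|P1 k - P2 k| <= 2 * c) ->
  (tv_dist P1 P2 <= c%:E)%E.
Proof.
move=> h; have -> : c%:E = ((2^-1)%:E * (2 * c)%:E)%E.
  by rewrite -EFinM mulKf.
rewrite /tv_dist; apply: lee_wpmul2l; first by rewrite lee_fin invr_ge0.
rewrite -nneseries_esumT => [|k]; last by rewrite lee_fin.
apply: lime_le.
  by apply: is_cvg_nneseries => k _ _; rewrite lee_fin.
by apply: nearW => N; rewrite sumEFin lee_fin.
Qed.

End TotalVariation.

(** * The two mass functions and their difference *)

Section Masses.
Variables (R : realType) (q : R).
Hypothesis hq : 2 <= q.
Let x : R := q^-1.

Let q_gt0 : 0 < q. Proof. by move: hq; lra. Qed.
Let q_neq0 : q != 0. Proof. by rewrite gt_eqF. Qed.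
Let x_gt0 : 0 < x. Proof. by rewrite invr_gt0. Qed.
Let x_le_half : x <= 2^-1. Proof. by rewrite lef_pV2 ?posrE. Qed.

Lemma prod_pow_sub m h : (h <= m)%N ->
  \prod_(0 <= j < h) (q ^+ m - q ^+ j) =
  q ^+ (m * h) * qprod x (m - h).+1 m.+1.
Proof.
elim: h => [|h IH] hm; first by rewrite big_geq// subn0 qprod_id muln0 mulr1.
rewrite big_nat_recr//= (IH (ltnW hm)) mulnS addnC exprD.
have -> : (m - h = (m - h.+1).+1)%N by lia.
rewrite (@qprod_recl _ _ (m - h.+1).+1); last by lia.
have -> : q ^+ m - q ^+ h = q ^+ m * (1 - x ^+ (m - h.+1).+1).
  have e : (m = h + (m - h.+1).+1)%N by lia.
  by rewrite mulrBr mulr1 /x exprVn {3}e exprD mulfK ?expf_neq0.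
by rewrite /=; ring.
Qed.

Lemma Qq_massE k :
  Qq_mass q k = x ^+ (k ^ 2) * (qprod_inf x k.+1 / qprod x 1 k.+1).
Proof.
have e i : 1 - 1 / q ^+ i = 1 - x ^+ i by rewrite div1r /x exprVn.
rewrite /Qq_mass div1r -exprVn -/x (eq_bigr _ (fun i _ => e i)).
by rewrite (_ : (fun i => 1 - 1 / q ^+ i) = (fun i => 1 - x ^+ i))//;
  apply/funext.
Qed.

Lemma Qqn_massE m k : (k <= m)%N ->
  Qqn_mass q m.*2 k =
  x ^+ (k ^ 2) *
    (qprod x (m - k).+1 m.+1 * qprod x k.+1 m.+1 / qprod x 1 k.+1).
Proof.
move=> km; rewrite /Qqn_mass /rank_count doubleK km.
have -> : ((m.*2 - 2 * k)./2 = m - k)%N by rewrite mul2n -doubleB doubleK.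
rewrite subKn// prodf_div !prod_pow_sub ?leq_subr// subnn subKn//.
have D0 : qprod x 1 k.+1 != 0 by rewrite gt_eqF// qprod_gt0.
have Em : q ^+ (m ^ 2) = q ^+ (m * k) * q ^+ (m * (m - k)).
  by rewrite -exprD -mulnDr subnKC// mulnn.
rewrite Em mulnn /x exprVn -/x; field.
by rewrite D0 !expf_neq0.
Qed.

(** The factor [qprod x k.+1 m.+1] is common to both masses, since it splits off
    the infinite product in the limiting one. *)
Lemma mass_diffE m k : (k <= m)%N ->
  Qqn_mass q m.*2 k - Qq_mass q k =
  x ^+ (k ^ 2) * (qprod x k.+1 m.+1 / qprod x 1 k.+1) *
    (qprod x (m - k).+1 m.+1 - qprod_inf x m.+1).
Proof.
move=> km; rewrite Qqn_massE// Qq_massE.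
by rewrite (@qprod_inf_cat _ _ x_gt0 x_le_half k.+1 m.+1)//; ring.
Qed.

Lemma mass_diff0E m :
  Qqn_mass q m.*2 0 - Qq_mass q 0 = qprod x 1 m.+1 * (1 - qprod_inf x m.+1).
Proof. by rewrite mass_diffE// subn0 !qprod_id divr1 mul1r. Qed.

Lemma mass_diff0_le m :
  `|Qqn_mass q m.*2 0 - Qq_mass q 0| <= 2 * x ^+ m.+1.
Proof.
have T1 := qprod_inf_le1 x_gt0 x_le_half m.+1.
have E0 := qprod_ge0 x_gt0 x_le_half 1 m.+1.
have E1 := qprod_le1 x_gt0 x_le_half 1 m.+1.
have D := qprod_inf_deficit x_gt0 x_le_half m.+1.
rewrite mass_diff0E ger0_norm ?mulr_ge0 ?subr_ge0//.
apply: le_trans (_ : 1 - qprod_inf x m.+1 <= _).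
  by rewrite ler_piMl// subr_ge0.
by apply: (le_double_of_deficit x_le_half) => //; rewrite subr_ge0.
Qed.

Lemma mass_diff0_ge m :
  4^-1 * x ^+ m.+1 <= `|Qqn_mass q m.*2 0 - Qq_mass q 0|.
Proof.
rewrite mass_diff0E; apply: le_trans (ler_norm _).
have y0 : 0 <= x ^+ m.+1 by rewrite exprn_ge0// ltW.
apply: ler_pM => //.
  apply: le_trans (qprod_ge_pentagonal x_gt0 x_le_half m).
  have : 0 <= x ^+ m.+2 by rewrite exprn_ge0// ltW.
  have : x ^+ 2 <= 4^-1.
    rewrite (_ : 4^-1 = 2^-1 ^+ 2); last by field.
    by rewrite ler_pXn2r// nnegrE ?invr_ge0// ltW.
  by move: x_le_half; lra.
by have := qprod_inf_le x_gt0 x_le_half m.+1; lra.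
Qed.

(** For [j < m] the two products compared in [mass_diffE] both have deficit at
    most [x^(m-j) (1 - x^(j+1)) / (1 - x)]: exactly the geometric sum for the
    finite one, and for the infinite one because [x^(j+1) <= 1 - x^(j+1)].  The
    factor [1 - x^(j+1)] then cancels the last factor of the denominator, and
    [(j+1)^2 + (m - j) = j(j+1) + (m+1)] exhibits the power [x^(m+1)].  For
    [j >= m] only the limiting mass remains, and [x^(m+1)] is split off from
    [x^((j+1)^2)] directly. *)
Lemma mass_diffS_le m j :
  `|Qqn_mass q m.*2 j.+1 - Qq_mass q j.+1| <= 2 * 2^-1 ^+ j * x ^+ m.+1.
Proof.
have sq_split : (j.+1 ^ 2 = j * j.+1 + j.+1)%N by rewrite -mulnn mulSn addnC.
have sub_split : (j < m)%N ->
    [/\ (m - j.+1).+1 = m - j, m.+1 = m - j + j.+1 & m - j <= m.+1]%N.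
  by split; lia.
have y0 i : 0 <= x ^+ i by rewrite exprn_ge0// ltW.
have yh : x ^+ j.+1 <= 2^-1 := pow_le_half x_gt0 x_le_half (ltn0Sn j).
have D0 : 0 < qprod x 1 j.+1 := qprod_gt0 x_gt0 x_le_half _ (ltn0Sn 0).
have Dn0 : qprod x 1 j.+1 != 0 by rewrite gt_eqF.
have u0 : 0 < 1 - x ^+ j.+1 by lra.
have key : x ^+ (j * j.+1) / qprod x 1 j.+1 <= 2^-1 ^+ j.
  by rewrite ler_pdivrMr//; exact: pronic_pow_le.
have a0 : 0 <= x ^+ (j * j.+1) / qprod x 1 j.+1 by rewrite divr_ge0// ltW.
case: (leqP j.+1 m) => jm.
  rewrite mass_diffE// (@qprod_recr _ x 1 j.+1)//.
  have [subE m1E m1_le] := sub_split jm; rewrite subE.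
  set W := qprod x (m - j) m.+1; set T := qprod_inf x m.+1.
  have W1 : W <= 1 := qprod_le1 x_gt0 x_le_half _ _.
  have T1 : T <= 1 := qprod_inf_le1 x_gt0 x_le_half _.
  have split_pow : x ^+ m.+1 = x ^+ (m - j) * x ^+ j.+1.
    by rewrite -exprD -m1E.
  have DW : (1 - x) * (1 - W) <= x ^+ (m - j) * (1 - x ^+ j.+1).
    rewrite [leRHS]mulrBr mulr1 -split_pow; exact: qprod_deficit.
  have DT : (1 - x) * (1 - T) <= x ^+ (m - j) * (1 - x ^+ j.+1).
    apply: le_trans (qprod_inf_deficit x_gt0 x_le_half _) _.
    by rewrite split_pow ler_wpM2l//; lra.
  have DWT : `|W - T| <= 2 * (x ^+ (m - j) * (1 - x ^+ j.+1)).
    have dW : 1 - W <= 2 * (x ^+ (m - j) * (1 - x ^+ j.+1)).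
      by apply: (le_double_of_deficit x_le_half) => //; rewrite subr_ge0.
    have dT : 1 - T <= 2 * (x ^+ (m - j) * (1 - x ^+ j.+1)).
      by apply: (le_double_of_deficit x_le_half) => //; rewrite subr_ge0.
    by rewrite ler_norml; apply/andP; split; lra.
  set E := qprod x j.+2 m.+1.
  have E0 : 0 <= E := qprod_ge0 x_gt0 x_le_half _ _.
  have E1 : E <= 1 := qprod_le1 x_gt0 x_le_half _ _.
  have C0 : 0 <= x ^+ (j.+1 ^ 2) * (E / (qprod x 1 j.+1 * (1 - x ^+ j.+1))).
    by rewrite mulr_ge0// divr_ge0// mulr_ge0// ltW.
  rewrite normrM (ger0_norm C0); apply: le_trans (ler_wpM2l C0 DWT) _.
  have -> : x ^+ (j.+1 ^ 2) * (E / (qprod x 1 j.+1 * (1 - x ^+ j.+1))) *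
      (2 * (x ^+ (m - j) * (1 - x ^+ j.+1))) =
      2 * (x ^+ (j * j.+1) / qprod x 1 j.+1 * E) * x ^+ m.+1.
    have -> : x ^+ (j.+1 ^ 2) = x ^+ (j * j.+1) * x ^+ j.+1.
      by rewrite -exprD -sq_split.
    by rewrite split_pow; field; rewrite Dn0 gt_eqF.
  apply: ler_wpM2r => //; apply: ler_wpM2l => //.
  by apply: (le_trans _ key); rewrite ler_piMr.
rewrite /Qqn_mass doubleK leqNgt jm /= sub0r normrN Qq_massE.
set T := qprod_inf x _.
have T0 : 0 <= T := qprod_inf_ge0 x_gt0 x_le_half _.
have T1 : T <= 1 := qprod_inf_le1 x_gt0 x_le_half _.
rewrite (@qprod_recr _ x 1 j.+1)// ger0_norm; last first.
  by rewrite mulr_ge0// divr_ge0// mulr_ge0// ltW.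
have -> : x ^+ (j.+1 ^ 2) * (T / (qprod x 1 j.+1 * (1 - x ^+ j.+1))) =
    (T / (1 - x ^+ j.+1)) * (x ^+ (j * j.+1) / qprod x 1 j.+1) * x ^+ j.+1.
  have -> : x ^+ (j.+1 ^ 2) = x ^+ (j * j.+1) * x ^+ j.+1.
    by rewrite -exprD -sq_split.
  by field; rewrite Dn0 gt_eqF.
have q0 : 0 <= T / (1 - x ^+ j.+1) by rewrite divr_ge0// ltW.
apply: ler_pM => //; first by rewrite mulr_ge0.
  by apply: ler_pM => //; rewrite ler_pdivrMr//; lra.
by rewrite ler_wiXn2l// ?(ltW x_gt0)//; move: x_le_half; lra.
Qed.

Lemma sum_mass_diff_le m N :
  \sum_(0 <= k < N) `|Qqn_mass q m.*2 k - Qq_mass q k| <=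
  2 * (3 * x ^+ m.+1).
Proof.
have y0 i : 0 <= x ^+ i by rewrite exprn_ge0// ltW.
case: N => [|N]; first by rewrite big_geq// !mulr_ge0.
(* [6 - 4 / 2^N] is [2] from [k = 0] plus the partial geometric sum. *)
suff h : \sum_(0 <= k < N.+1) `|Qqn_mass q m.*2 k - Qq_mass q k| <=
    (6 - 4 * 2^-1 ^+ N) * x ^+ m.+1.
  apply: le_trans h _; rewrite mulrA ler_wpM2r//.
  have : 0 <= (2^-1 : R) ^+ N by rewrite exprn_ge0// invr_ge0.
  lra.
elim: N => [|N IH].
  rewrite big_nat1 expr0; apply: le_trans (mass_diff0_le m) _.
  by have := y0 m.+1; lra.
rewrite big_nat_recr//=; apply: le_trans (lerD IH (mass_diffS_le m N)) _.
by rewrite (exprS 2^-1 N) le_eqVlt; apply/orP; left; apply/eqP; field.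
Qed.

End Masses.

Theorem corollary6p1 (R : realType) (q : R) (hq : 2 <= q)
    (n : nat) (hn : ~~ odd n) :
  ((1 / (8 * q ^+ (n./2 + 1)))%:E <= tv_dist (Qqn_mass q n) (Qq_mass q))%E /\
  (tv_dist (Qqn_mass q n) (Qq_mass q) <= (3 / q ^+ (n./2 + 1))%:E)%E.
Proof.
have nE : n = (n./2).*2 by rewrite even_halfK.
rewrite {2 3}nE addn1; split.
  apply: le_trans (tv_dist_ge_point _ _ 0%N); rewrite lee_fin.
  have := mass_diff0_ge hq n./2.
  by rewrite div1r invfM -exprVn; lra.
apply: tv_dist_le_partial_sums => N.
by rewrite -exprVn; exact: (sum_mass_diff_le hq).
Qed.
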